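(* Let $n,d\ge1$ be integers and $\sigma,B,P,\sigma_0>0$. In the Gaussian location model, suppose each user uses the encoding function $f^*(u)=\sqrt{\frac{P}{B^2+\sigma^2}}\,u$ over the Gaussian multiple-access channel with $s=d$ channel uses. Then for every $\theta\in\Theta$ and every $1\le i\le n$, $$I_\theta(Y;U_i)\le\frac d2\cdot\frac{1}{n-1+\frac{\sigma_0^2(B^2+\sigma^2)}{P\sigma^2}}.$$
   Context: Gaussian location model: $\Theta=\{\theta\in\mathbb R^d:\|\theta\|_2\le B\sqrt d\}$ and $p_\theta=\mathcal N(\theta,\sigma^2I_d)$. Users' data $U_1,\dots,U_n$ are i.i.d. with law $p_\theta$, and user $i$ sends $X_i=f^*(U_i)\in\mathbb R^d$. The processor receives $Y=\sum_{i=1}^nX_i+Z$ with $Z\sim\mathcal N(0,\sigma_0^2I_d)$ independent of the $U_i$. $I_\theta(\cdot;\cdot)$ denotes mutual information (natural logarithm) when the data have law $p_\theta$. *)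

(* Defs.v *)
(* MathComp-Analysis *)
From HB Require Import structures.
From mathcomp Require Import all_boot all_order all_algebra.
From mathcomp Require Import all_classical all_reals all_analysis.

Set Implicit Arguments.
Unset Strict Implicit.
Unset Printing Implicit Defensive.

Import Order.TTheory GRing.Theory Num.Theory.
Import numFieldNormedType.Exports.

Local Open Scope classical_set_scope.
Local Open Scope ring_scope.

(* A vector of R^d is a [d.-tuple R]; the library equips this type with the
   product sigma-algebra, i.e. the Borel sigma-algebra of R^d. *)

Definition l2norm (R : realType) (d : nat) (x : d.-tuple R) : R :=
  Num.sqrt (\sum_(j < d) tnth x j ^+ 2).

Definition param_space (R : realType) (d : nat) (B : R) : set (d.-tuple R) :=
  [set theta | l2norm theta <= B * Num.sqrt d%:R].

(* [mu] is N(m, s^2 I_d), the product of the measures N(m_j, s^2), 1 <= j <= d.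
   The second argument of [normal_prob] is the standard deviation. *)
Definition isotropic_normal (R : realType) (d : nat) (m : d.-tuple R) (s : R)
    (mu : set (d.-tuple R) -> \bar R) : Prop :=
  forall A : 'I_d -> set R, (forall j, measurable (A j)) ->
    mu [set x | forall j, A j (tnth x j)] =
    (\prod_(j < d) normal_prob (tnth m j) s (A j))%E.

Section random_variables.
Context {disp disp1 disp2 : measure_display} {Omega : measurableType disp}.
Context {T1 : measurableType disp1} {T2 : measurableType disp2} {R : realType}.
Variable Pr : probability Omega R.

Definition independent_family (I : finType) (X : I -> Omega -> T1) : Prop :=
  forall (J : {set I}) (A : I -> set T1), (forall i, measurable (A i)) ->
    Pr (\bigcap_(i in [set` J]) (X i @^-1` A i)) =
    (\prod_(i in J) Pr (X i @^-1` A i))%E.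

Definition independent_pair (X : Omega -> T1) (Y : Omega -> T2) : Prop :=
  forall (A : set T1) (B : set T2), measurable A -> measurable B ->
    Pr (X @^-1` A `&` Y @^-1` B) = (Pr (X @^-1` A) * Pr (Y @^-1` B))%E.

Definition pair_RV (X : {RV Pr >-> T1}) (Y : {RV Pr >-> T2}) :
  Omega -> T1 * T2 := fun w => (X w, Y w).

Lemma measurable_pair_RV (X : {RV Pr >-> T1}) (Y : {RV Pr >-> T2}) :
  measurable_fun setT (pair_RV X Y).
Proof. exact: measurable_fun_pair. Qed.

HB.instance Definition _ (X : {RV Pr >-> T1}) (Y : {RV Pr >-> T2}) :=
  isMeasurableFun.Build _ _ _ _ (pair_RV X Y) (measurable_pair_RV X Y).

End random_variables.

(* The negative part of the integrand is always [nu]-integrable, so that the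
   integral is a well-defined element of [0, +oo]. *)
Definition kl_divergence {disp : measure_display} {T : measurableType disp}
    {R : realType} (nu mu : probability T R) : \bar R :=
  if pselect (nu `<< mu) then
    (\int[nu]_x lne (Radon_Nikodym (charge_of_finite_measure nu) mu x))%E
  else +oo%E.

Definition mutual_information {disp disp1 disp2 : measure_display}
    {Omega : measurableType disp} {T1 : measurableType disp1}
    {T2 : measurableType disp2} {R : realType} (Pr : probability Omega R)
    (X : {RV Pr >-> T1}) (Y : {RV Pr >-> T2}) : \bar R :=
  kl_divergence (distribution Pr (pair_RV X Y))
    (distribution Pr X \x distribution Pr Y)%E.

Definition encoder (R : realType) (d : nat) (P B sigma : R)
    (u : d.-tuple R) : d.-tuple R :=
  [tuple Num.sqrt (P / (B ^+ 2 + sigma ^+ 2)) * tnth u j | j < d].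

Definition mac_output (R : realType) (n d : nat)
    (X : 'I_n -> d.-tuple R) (Z : d.-tuple R) : d.-tuple R :=
  [tuple \sum_(i < n) tnth (X i) j + tnth Z j | j < d].

(* Main.v *)
(* Write [Y = W + a U_i] where [W] collects the noise and the other users.
   Sums of independent Gaussian vectors are Gaussian, so [W] is isotropic of
   variance [t^2 = sigma0^2 + (n-1) a^2 sigma^2], independent of [U_i], and [Y]
   is isotropic of variance [q^2 = t^2 + a^2 sigma^2].  The law of [(Y, U_i)]
   then has, with respect to the product of its marginals, the density
   [prod_j N(m_j + a u_j, t^2)(y_j) / N(m'_j, q^2)(y_j)], where [m] and [m'] are
   the means of [W] and [Y].  Integrating its logarithm, the two quadratic terms
   cancel and [I(Y; U_i) = d ln (q / t)
   = (d / 2) ln (1 + a^2 sigma^2 / t^2) <= (d / 2) (a^2 sigma^2 / t^2)]. *)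
Require Import Defs.
From HB Require Import structures.
From mathcomp Require Import all_boot all_order all_algebra.
From mathcomp Require Import all_classical all_reals all_analysis.
From mathcomp Require Import measurable_realfun ring lra.

Set Implicit Arguments.
Unset Strict Implicit.
Unset Printing Implicit Defensive.

Import Order.TTheory GRing.Theory Num.Theory.
Import numFieldNormedType.Exports.

Local Open Scope classical_set_scope.
Local Open Scope ring_scope.

(** The hypotheses describe the Gaussian laws and the independence through product sets only. Every
    multidimensional fact is therefore proved on boxes, where it splits into one-dimensional
    integrals, and then extended to all measurable sets because boxes form a generating pi-system.
    Closure of Gaussians under sums comes from Bayes' formula rather than from characteristic
    functions: given the input [u], an output coordinate is normal with mean [m + a u], and the
    joint density is also the output density times a posterior density in [u], of mass 1. The
    quadratic terms cancel because every squared deviation divided by its variance has the same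
    expectation [K], the standard second moment; [K] has to be finite for the logarithm to be
    integrated term by term. To build [W], independence of a partial sum from one further user is
    too weak to iterate; the induction carries independence from all the remaining users jointly. *)

Lemma measurable_indic_comp d1 d2 (T1 : measurableType d1)
    (T2 : measurableType d2) (R : realType) (X : T1 -> T2) (A : set T2) :
  measurable_fun [set: T1] X -> measurable A ->
  measurable_fun [set: T1] (fun x => (\1_A (X x))%:E : \bar R).
Proof.
move=> mX mA; apply/measurable_EFinP.
exact: (measurableT_comp (measurable_indic mA) mX).
Qed.

(** * Integrals under a weighted image measure *)

Section weighted_integral.
Local Open Scope ereal_scope.
Context d1 d2 (T1 : measurableType d1) (T2 : measurableType d2) (R : realType).
Variables (mu : {measure set T1 -> \bar R}) (nu : {measure set T2 -> \bar R}).
Variables (X : T1 -> T2) (G : T1 -> R) (c : R).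
Hypotheses (mX : measurable_fun [set: T1] X) (mG : measurable_fun [set: T1] G).
Hypothesis G0 : forall x, (0 <= G x)%R.
Hypothesis GX : forall A, measurable A ->
  \int[mu]_x ((G x)%:E * (\1_A (X x))%:E) = c%:E * nu A.

Import HBNNSimple.

Let mEG : measurable_fun [set: T1] (EFin \o G).
Proof. exact/measurable_EFinP. Qed.

Let weighted_nnsfun (h : {nnsfun T2 >-> R}) :
  \int[mu]_x ((G x)%:E * (h (X x))%:E) = c%:E * \int[nu]_y (h y)%:E.
Proof.
have m1 r : measurable (h @^-1` [set r]).
  by rewrite -[X in measurable X]setTI; exact: measurable_funP.
have m1X r : measurable_fun setT
    (fun x => (\1_(h @^-1` [set r]) (X x))%:E : \bar R).
  exact: measurable_indic_comp.
transitivity (\int[mu]_x (\sum_(r \in range h)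
   (r%:E * ((G x)%:E * (\1_(h @^-1` [set r]) (X x))%:E)))).
  apply: eq_integral => x _; rewrite fimfunE -fsumEFin// ge0_mule_fsumr.
    by apply: eq_fsbigr => r _; rewrite EFinM muleCA.
  by move=> r; exact: nnfun_muleindic_ge0.
rewrite ge0_integral_fsum//; last 2 first.
- by move=> r; apply: emeasurable_funM => //; exact: emeasurable_funM.
- move=> r x _; rewrite muleCA; apply: mule_ge0; first by rewrite lee_fin.
  exact: nnfun_muleindic_ge0.
transitivity (\sum_(r \in range h) (c%:E * (r%:E * nu (h @^-1` [set r])))).
  apply: eq_fsbigr => r /[!inE] -[y _ yr].
  rewrite ge0_integralZl//; last 3 first.
  - exact: emeasurable_funM.
  - by move=> x _; rewrite mule_ge0// lee_fin.
  - by rewrite lee_fin -yr.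
  by rewrite GX// muleCA.
rewrite -ge0_mule_fsumr; last first.
  move=> r; have [r0|r0] := leP 0%R r; first by rewrite mule_ge0// lee_fin.
  by rewrite preimage_nnfun0// measure0 mule0.
by rewrite integral_nnsfun// patch_setT sintegralE.
Qed.

(** The hypothesis [GX] is the case of indicators; simple functions and monotone convergence give
    the rest. With [G = 1] this is a change of variables, with [X = id] integration against a
    density; in the product formula [G] collects the other factors and [c] is their integral. *)
Lemma ge0_weighted_integral f : measurable_fun [set: T2] f ->
  (forall y, 0 <= f y) ->
  \int[mu]_x ((G x)%:E * f (X x)) = c%:E * \int[nu]_y f y.
Proof.
move=> mf f0; pose h := nnsfun_approx measurableT mf.
have cvh y : (h n y)%:E @[n --> \oo] --> f y.
  by apply: cvg_nnsfun_approx => //.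
have ndh y : {homo (fun n => (h n y)%:E) : m n / (m <= n)%N >-> m <= n}.
  by move=> m n mn; rewrite lee_fin; exact/lefP/nd_nnsfun_approx.
have -> : \int[nu]_y f y = limn (fun n => \int[nu]_y (h n y)%:E).
  rewrite -monotone_convergence//; last 2 first.
  - by move=> n; exact/measurable_EFinP.
  - by move=> n y _; rewrite lee_fin.
  by apply: eq_integral => y _; apply/esym/cvg_lim => //; exact: cvh.
have -> : \int[mu]_x ((G x)%:E * f (X x)) =
    limn (fun n => \int[mu]_x ((G x)%:E * (h n (X x))%:E)).
  rewrite -monotone_convergence//; last 3 first.
  - move=> n; apply: emeasurable_funM => //; apply/measurable_EFinP.
    exact: measurableT_comp.
  - by move=> n x _; rewrite mule_ge0// lee_fin.
  - by move=> x _ m n mn; apply: lee_wpmul2l; [rewrite lee_fin|exact: ndh].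
  apply: eq_integral => x _; apply/esym/cvg_lim => //.
  by apply: cvgeZl => //; exact: cvh.
under [X in limn X]funext do rewrite weighted_nnsfun.
rewrite limeMl//.
apply: ereal_nondecreasing_is_cvgn => m n mn.
apply: ge0_le_integral => //.
- by move=> y _; rewrite lee_fin.
- exact/measurable_EFinP.
- exact/measurable_EFinP.
- by move=> y _; exact: ndh.
Qed.

End weighted_integral.

(** * Product functions under a law known on boxes *)

Section product_law.
Local Open Scope ereal_scope.
Context d d' (T : measurableType d) (S : measurableType d') (R : realType).
Context (I : finType) (mu : {measure set T -> \bar R}).
Variables (X : I -> T -> S) (P : I -> probability S R).
Hypothesis mX : forall i, measurable_fun [set: T] (X i).
Hypothesis muX : forall A : I -> set S, (forall i, measurable (A i)) ->
  mu [set x | forall i, A i (X i x)] = \prod_i P i (A i).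

Lemma integral_product_law (f : I -> S -> R) :
  (forall i, measurable_fun [set: S] (f i)) -> (forall i s, (0 <= f i s)%R) ->
  (forall i, \int[P i]_s (f i s)%:E < +oo) ->
  \int[mu]_x (\prod_i f i (X i x))%:E = \prod_i \int[P i]_s (f i s)%:E.
Proof.
have int_indic i A : measurable A -> \int[P i]_s (\1_A s)%:E = P i A.
  by move=> mA; rewrite integral_indic// setIT.
(* Replace the indicator functions, for which the identity is [muX], by the
   functions [f i] one index at a time: [s] lists the indices already treated. *)
suff H (s : seq I) : forall f : I -> S -> R,
    (forall i, i \notin s -> exists2 A, measurable A & f i = \1_A) ->
    (forall i, measurable_fun [set: S] (f i)) ->
    (forall i x, (0 <= f i x)%R) ->
    (forall i, \int[P i]_s (f i s)%:E < +oo) ->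
    \int[mu]_x (\prod_i f i (X i x))%:E = \prod_i \int[P i]_s (f i s)%:E.
  by apply: (H (index_enum I)) => i; rewrite mem_index_enum.
elim: s => [|k s IH] {}f f1 mf f0 fy.
  have /choice[A fA] i : exists A, measurable A /\ f i = \1_A.
    by have [//|A mA fA] := f1 i; exists A.
  have mA i : measurable (A i) by case: (fA i).
  rewrite (eq_bigr (fun i => P i (A i))); last first.
    by move=> i _; rewrite (fA i).2 int_indic.
  rewrite -muX//.
  have mAX : measurable [set x | forall i, A i (X i x)].
    rewrite (_ : mkset _ = \bigcap_(i in [set: I]) (X i @^-1` A i)).
      apply: fin_bigcap_measurable => // i _.
      by rewrite -[X in measurable X]setTI; exact: mX.
    by apply/seteqP; split=> x /= => [h i _|h i]; exact: h.
  rewrite -[X in mu X]setIT -(integral_indic mu measurableT mAX).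
  apply: eq_integral => x _; congr EFin; rewrite indicE.
  case: (boolP (x \in _)) => [/set_mem/= Ax|/negP xA].
    by apply: big1 => i _; rewrite (fA i).2 indicE mem_set.
  have [i nAi] : exists i, ~ A i (X i x).
    by apply/existsNP => Ax; apply: xA; apply/mem_set.
  rewrite (bigD1 i)//= (fA i).2 indicE memNset ?mul0r//.
(* [g] drops factor [k], and [fA A] puts the indicator of [A] in its place. The induction hypothesis
   for [fA A] says that weighting [mu] by the other factors turns the law of [X k] into [c] times
   [P k], against which [f k] is then integrated. *)
pose g i := if i == k then cst 1%R else f i.
pose fA (A : set S) i : S -> R := if i == k then \1_A else f i.
pose c := \prod_(i | i != k) \int[P i]_s (f i s)%:E.
have int0 i : 0 <= \int[P i]_s (f i s)%:E.
  by apply: integral_ge0 => s' _; rewrite lee_fin.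
have c_fin : c \is a fin_num.
  by apply: prode_fin_num => i _; rewrite ge0_fin_numE.
have gE (h : S -> R) x : (\prod_i g i (X i x) * h (X k x) =
    h (X k x) * \prod_(i | i != k) f i (X i x))%R.
  rewrite mulrC (bigD1 k)//= /g eqxx mul1r; congr (_ * _)%R.
  by apply: eq_bigr => i /negPf ->.
transitivity (\int[mu]_x ((\prod_i g i (X i x))%:E * (f k (X k x))%:E)).
  by apply: eq_integral => x _; rewrite -EFinM gE (bigD1 k).
rewrite (@ge0_weighted_integral _ _ _ _ _ mu (P k) (X k) _ (fine c) _ _ _ _
    (EFin \o f k))//.
- by rewrite fineK// muleC [RHS](bigD1 k).
- apply: measurable_prod => i _; rewrite /g; case: eqP => _.
    exact: measurable_cst.
  exact: measurableT_comp (mf i) (mX i).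
- by move=> x; apply: prodr_ge0 => i _; rewrite /g; case: eqP.
- move=> A mA; rewrite fineK// muleC.
  transitivity (\int[mu]_x (\prod_i fA A i (X i x))%:E).
    apply: eq_integral => x _; rewrite -EFinM gE /fA [in RHS](bigD1 k)//= eqxx.
    by congr (_ * _)%:E; apply: eq_bigr => i /negPf ->.
  rewrite IH//.
  + rewrite (bigD1 k)//= /fA eqxx int_indic//; congr (_ * _).
    by apply: eq_bigr => i /negPf ->.
  + move=> i nis; rewrite /fA; case: (eqVneq i k) => [_|ik]; first by exists A.
    by apply: f1; rewrite inE negb_or ik.
  + by move=> i; rewrite /fA; case: (eqVneq i k).
  + by move=> i x; rewrite /fA; case: (eqVneq i k).
  + move=> i; rewrite /fA; case: (eqVneq i k) => [->|//].
    by rewrite int_indic// (le_lt_trans (probability_le1 _ mA))// ltry.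
- exact/measurable_EFinP.
- by move=> x; rewrite /= lee_fin.
Qed.

End product_law.

(** * Uniqueness of measures from rectangles and boxes *)

Lemma measure_eq_rectangle d1 d2 (T1 : measurableType d1) (T2 : measurableType d2)
    (R : realType) (m1 m2 : {measure set (T1 * T2)%type -> \bar R}) :
  (forall A B, measurable A -> measurable B -> m1 (A `*` B) = m2 (A `*` B)) ->
  (m1 setT < +oo)%E -> forall C, measurable C -> m1 C = m2 C.
Proof.
move=> m12 m1y C mC.
apply: (measure_unique [set A `*` B | A in measurable & B in measurable]
  (fun=> setT)) => //.
- exact: measurable_prod_measurableType.
- move=> _ _ [A mA [B mB <-]] [A' mA' [B' mB' <-]].
  by rewrite -setXI; exists (A `&` A'); [exact: measurableI|];
    exists (B `&` B'); [exact: measurableI|].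
- by move=> _; exists setT => //; exists setT => //; rewrite setXTT.
- by rewrite bigcup_const.
- by move=> _ [A mA [B mB <-]]; exact: m12.
Qed.

(** Coordinate [j] of both tuples is constrained at the same place, so that the measure of a box
    becomes a single product over [j]. *)
Definition box d d' (T : measurableType d) (T' : measurableType d') (n : nat)
    (A : 'I_n -> set T) (B : 'I_n -> set T') : set (n.-tuple T * n.-tuple T')%type :=
  [set x | forall j, A j (tnth x.1 j) /\ B j (tnth x.2 j)].

Lemma box_setX d d' (T : measurableType d) (T' : measurableType d') (n : nat)
    (A : 'I_n -> set T) (B : 'I_n -> set T') :
  box A B = [set x | forall j, A j (tnth x j)] `*`
            [set x | forall j, B j (tnth x j)].
Proof.
by apply/seteqP; split=> x /= => [h|[h1 h2] j]; split=> // j; case: (h j).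
Qed.

Lemma measurable_tuple_box d (T : measurableType d) (n : nat)
    (A : 'I_n -> set T) : (forall j, measurable (A j)) ->
  measurable [set x : n.-tuple T | forall j, A j (tnth x j)].
Proof.
move=> mA.
rewrite (_ : mkset _ = \bigcap_(j in [set: 'I_n]) ((@tnth n T ^~ j) @^-1` A j)).
  apply: fin_bigcap_measurable => // j _.
  by rewrite -[X in measurable X]setTI; exact: measurable_tnth.
by apply/seteqP; split=> x /= => [h j _|h j]; exact: h.
Qed.

Lemma measurable_box d d' (T : measurableType d) (T' : measurableType d')
    (n : nat) (A : 'I_n -> set T) (B : 'I_n -> set T') :
  (forall j, measurable (A j)) -> (forall j, measurable (B j)) ->
  measurable (box A B).
Proof.
by move=> mA mB; rewrite box_setX; apply: measurableX; exact: measurable_tuple_box.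
Qed.

Lemma measure_eq_box d d' (T : measurableType d) (T' : measurableType d')
    (R : realType) (n : nat)
    (m1 m2 : {measure set (n.-tuple T * n.-tuple T')%type -> \bar R}) :
  (forall A B, (forall j, measurable (A j)) -> (forall j, measurable (B j)) ->
    m1 (box A B) = m2 (box A B)) ->
  (m1 setT < +oo)%E -> forall C, measurable C -> m1 C = m2 C.
Proof.
move=> m12 m1y C mC.
pose G : set (set (n.-tuple T * n.-tuple T')%type) := [set E | exists A B,
  [/\ forall j, measurable (A j), forall j, measurable (B j) & E = box A B]].
have GT : G setT.
  by exists (fun=> setT), (fun=> setT); split=> //; apply/seteqP; split.
(* The generated sigma-algebra <<s G>> makes all the coordinates measurable,
   hence also the identity into the product sigma-algebra. *)
pose id' : g_sigma_algebraType G -> (n.-tuple T * n.-tuple T')%type := id.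
have mid : measurable_fun setT id'.
  apply/measurable_fun_pairP; split; apply/measurable_fun_tnthP => j.
  - move=> _ E mE; rewrite setTI; apply: sub_sigma_algebra.
    exists (fun k => if k == j then E else setT), (fun=> setT); split=> //.
      by move=> k; case: ifP.
    apply/seteqP; split=> x /= => [Ex k|/(_ j)[]]; last by rewrite eqxx.
    by case: eqP => // ->.
  - move=> _ E mE; rewrite setTI; apply: sub_sigma_algebra.
    exists (fun=> setT), (fun k => if k == j then E else setT); split=> //.
      by move=> k; case: ifP.
    apply/seteqP; split=> x /= => [Ex k|/(_ j)[_]]; last by rewrite eqxx.
    by case: eqP => // ->.
apply: (g_sigma_algebra_measure_unique G _ (fun=> setT)) => //.
- by move=> _ [A [B [mA mB ->]]]; exact: measurable_box.
- by rewrite bigcup_const.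
- move=> _ _ [A [B [mA mB ->]]] [A' [B' [mA' mB' ->]]].
  exists (fun j => A j `&` A' j), (fun j => B j `&` B' j).
  split=> [j|j|]; [exact: measurableI|exact: measurableI|].
  apply/seteqP; split=> x /= => [[h h'] j|h].
    by have [? ?] := h j; have [? ?] := h' j.
  by split=> j; have [[? ?] [? ?]] := h j.
- by move=> _ [A [B [mA mB ->]]]; exact: m12.
- by have := mid measurableT C mC; rewrite setTI.
Qed.

(** * Relative entropy from an explicit density *)

(** The Radon-Nikodym derivative is determined only up to [mu]-null sets. These are [nu]-null by
    domination, so the integral against [nu] does not see the choice. *)
Lemma kl_divergence_density d (T : measurableType d) (R : realType)
    (nu mu : probability T R) (f : T -> R) :
  measurable_fun setT f -> (forall x, 0 <= f x) ->
  (forall A, measurable A -> nu A = \int[mu]_(x in A) (f x)%:E)%E ->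
  kl_divergence nu mu = (\int[nu]_x lne (f x)%:E)%E.
Proof.
move=> mf f0 nuf.
have numu : nu `<< mu.
  apply/null_content_dominatesP => A mA muA0; rewrite nuf//.
  apply: null_set_integral => //.
  exact/measurable_EFinP/measurable_funTS.
rewrite /kl_divergence; case: pselect => // numu'.
have fi : mu.-integrable setT (EFin \o f).
  apply/integrableP; split; first exact/measurable_EFinP.
  under eq_integral do rewrite /= ger0_norm//.
  by rewrite -nuf// probability_setT ltry.
set g := Radon_Nikodym _ _.
have gfin x : g x = (fine (g x))%:E by rewrite fineK// Radon_Nikodym_fin_num.
have gi : mu.-integrable setT g by exact: Radon_Nikodym_integrable.
have mg : measurable_fun setT g by exact: measurable_int gi.
have gf : ae_eq nu setT g (EFin \o f).
  have : ae_eq mu setT g (EFin \o f).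
    apply: integral_ae_eq => //; first exact/measurable_EFinP.
    by move=> A _ mA; rewrite -Radon_Nikodym_integral// -nuf.
  exact: null_dominates_ae_eq numu.
have mlne (h : T -> R) : measurable_fun setT h ->
    measurable_fun setT (fun x => lne (h x)%:E).
  move=> mh.
  rewrite (_ : (fun x => _) =
      (fun x => if h x <= 0 then -oo%E else (ln (h x))%:E)); last first.
    by apply/funext => x; rewrite /lne.
  apply: measurable_fun_ifT => //.
  - by apply: measurable_fun_ler.
  - by apply/measurable_EFinP; exact: measurableT_comp.
apply: ae_eq_integral => //.
- rewrite (_ : (fun x => _) = (fun x => lne (fine (g x))%:E)).
    by apply: mlne; exact: measurableT_comp.
  by apply/funext => x; rewrite -gfin.
- exact: mlne.
- by apply: filterS gf => x /= + xT => /(_ xT) ->.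
Qed.

(** * Normal laws on the line: density and translation *)

Section normal_law.
Context (R : realType).
Implicit Types m s t a c u x y : R.
Local Notation leb := (@lebesgue_measure R).

Lemma normal_pdf_gt0 m s x : s != 0 -> 0 < normal_pdf m s x.
Proof.
by move=> s0; rewrite normal_pdfE// mulr_gt0 ?expR_gt0// normal_peak_gt0.
Qed.

Lemma normal_pdf_shift m s x c : s != 0 ->
  normal_pdf (m + c) s (x + c) = normal_pdf m s x.
Proof.
move=> s0; rewrite !normal_pdfE// /normal_fun.
by have -> : x + c - (m + c) = x - m by ring.
Qed.

Lemma ge0_integral_normal_prob m s (f : R -> \bar R) :
  measurable_fun [set: R] f -> (forall x, 0 <= f x)%E ->
  (\int[normal_prob m s]_x f x =
   \int[leb]_x ((normal_pdf m s x)%:E * f x))%E.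
Proof.
move=> mf f0; apply/esym.
rewrite (@ge0_weighted_integral _ _ _ _ _ leb (normal_prob m s) id
  (normal_pdf m s) 1) ?mul1e//.
- exact: measurable_normal_pdf.
- by move=> x; exact: normal_pdf_ge0.
move=> A mA; rewrite mul1e /normal_prob [RHS]integral_mkcond.
apply: eq_integral => x _.
by rewrite epatch_indic.
Qed.

(** The image of Lebesgue measure under a translation gives every half-open interval its length,
    which characterises the measure. *)
Lemma lebesgue_measure_shift c (A : set R) : measurable A ->
  leb [set x | A (x + c)] = leb A.
Proof.
move=> mA.
have mc : measurable_fun [set: R] (fun x : R => x + c).
  exact: measurable_funD.
pose phi : measurableTypeR R -> measurableTypeR R := fun x => x + c.
apply/esym; apply: (@lebesgue_measure_unique R (pushforward leb phi)) => //.
move=> _ [[a b] _ <-] /=.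
transitivity (leb `]a - c, b - c]%classic).
  rewrite !lebesgue_measure_itv/= !lte_fin ltrD2r.
  by case: ifP => // _; congr EFin; ring.
congr (leb _); apply/seteqP; split=> x /=.
  by rewrite /= !in_itv/= ltrBlDr lerBrDr.
by rewrite /= !in_itv/= ltrBlDr lerBrDr.
Qed.

Lemma ge0_integral_shift c (f : R -> \bar R) : measurable_fun [set: R] f ->
  (forall x, 0 <= f x)%E ->
  (\int[leb]_x f (x + c)%R = \int[leb]_x f x)%E.
Proof.
move=> mf f0.
have mc : measurable_fun [set: R] (fun x : R => x + c).
  exact: measurable_funD.
transitivity (\int[leb]_x ((cst (1:R) x)%:E * f (x + c)%R))%E.
  by apply: eq_integral => x _; rewrite mul1e.
rewrite (@ge0_weighted_integral _ _ _ _ _ leb leb (fun x => x + c) (cst 1) 1) ?mul1e//.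
move=> A mA; rewrite mul1e; apply: (etrans _ (lebesgue_measure_shift c mA)).
have mcA : measurable [set x | A (x + c)].
  by have := mc measurableT A mA; rewrite setTI.
rewrite -[X in leb X]setIT -(integral_indic leb measurableT mcA).
by apply: eq_integral => x _; rewrite mul1e.
Qed.

(** Used with [c = a x] to turn the law of the noise into the law of the output given the input
    [x]. *)
Lemma normal_prob_shift m s c (A : set R) : s != 0 -> measurable A ->
  normal_prob m s [set x | A (x + c)] = normal_prob (m + c) s A.
Proof.
move=> s0 mA.
have mc : measurable_fun [set: R] (fun x : R => x + c).
  exact: measurable_funD.
have mcA : measurable [set x | A (x + c)].
  by have := mc measurableT A mA; rewrite setTI.
rewrite /normal_prob integral_mkcond [RHS]integral_mkcond.
rewrite -[RHS](ge0_integral_shift c).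
- apply: eq_integral => x _; rewrite !epatch_indic.
  by rewrite normal_pdf_shift.
- apply: (measurable_restrictT _ _).1 => //.
  apply: measurable_funTS; apply/measurable_EFinP.
  exact: measurable_normal_pdf.
- by move=> x; apply: erestrict_ge0 => y _; rewrite lee_fin normal_pdf_ge0.
Qed.

End normal_law.

(** * Normal mixtures of normal laws *)

Section gaussian_mixture.
Context (R : realType).
Implicit Types m s t a c u x y : R.
Local Notation leb := (@lebesgue_measure R).

Lemma normal_peakE s : 0 < s -> normal_peak s = (s * Num.sqrt (pi *+ 2))^-1.
Proof.
move=> s0; rewrite /normal_peak -mulrnAr sqrtrM ?sqr_ge0// sqrtr_sqr.
by rewrite gtr0_norm.
Qed.

(* The joint density of [(u, y)], factored in the two possible orders. *)
Lemma normal_pdf_mixture m th s t a q u y : 0 < s -> 0 < t -> 0 < q ->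
  q ^+ 2 = t ^+ 2 + a ^+ 2 * s ^+ 2 ->
  normal_pdf th s u * normal_pdf (m + a * u) t y =
  normal_pdf (m + a * th) q y *
  normal_pdf (th + a * s ^+ 2 * (y - m - a * th) / q ^+ 2) (s * t / q) u.
Proof.
move=> s0 t0 q0 qE.
have r0 : 0 < s * t / q by rewrite divr_gt0// mulr_gt0.
(* Peaks and exponents are matched separately. The peaks agree because [s t = q (s t / q)]; the
   exponents agree by completing the square in [u], which is where the posterior mean and deviation
   come from. *)
rewrite !normal_pdfE ?gt_eqF// mulrACA [RHS]mulrACA; congr (_ * _).
  have k0 : 0 < Num.sqrt (pi *+ 2) :> R.
    by rewrite sqrtr_gt0 mulrn_wgt0// pi_gt0.
  rewrite !normal_peakE//; field.
  by rewrite !gt_eqF.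
rewrite /normal_fun -!expRD; congr expR.
rewrite !expr_div_n !exprMn qE -[_ *+ 2]mulr_natl.
rewrite -(mulr_natl (t ^+ 2) 2) -(mulr_natl (_ + _) 2) -(mulr_natl (_ / _) 2).
have Q0 : t ^+ 2 + a ^+ 2 * s ^+ 2 != 0 by rewrite -qE gt_eqF// exprn_gt0.
have s0' : s != 0 by rewrite gt_eqF.
have t0' : t != 0 by rewrite gt_eqF.
by field; rewrite exprMn Q0 t0' s0'.
Qed.

Lemma measurable_normal_pdf_channel m t a : t != 0 ->
  measurable_fun [set: R * R] (fun z : R * R => normal_pdf (m + a * z.1) t z.2).
Proof.
move=> t0.
rewrite (_ : (fun z => _) = (fun z : R * R =>
    normal_peak t * expR (- (z.2 - (m + a * z.1)) ^+ 2 / (t ^+ 2 *+ 2)))); last first.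
  by apply/funext => z; rewrite normal_pdfE.
apply: measurable_funM => //; apply: measurableT_comp => //.
apply: measurable_funM => //; apply: measurableT_comp => //.
apply: measurable_funX; apply: measurable_funB => //.
by apply: measurable_funD => //; exact: measurable_funM.
Qed.

Let slice m t a (A : set R) (z : R * R) : \bar R :=
  (normal_pdf (m + a * z.1) t z.2)%:E * (\1_A z.2)%:E.

Let slice_ge0 m t a A z : (0 <= slice m t a A z)%E.
Proof. by apply: mule_ge0; rewrite lee_fin// normal_pdf_ge0. Qed.

Let measurable_slice m t a A : t != 0 -> measurable A ->
  measurable_fun [set: R * R] (slice m t a A).
Proof.
move=> t0 mA; apply: emeasurable_funM.
  by apply/measurable_EFinP; exact: measurable_normal_pdf_channel.
exact: measurable_indic_comp.
Qed.

Let normal_prob_slice m t a A u :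
  (normal_prob (m + a * u) t A = \int[leb]_y slice m t a A (u, y))%E.
Proof.
rewrite /normal_prob integral_mkcond.
by apply: eq_integral => x _; rewrite epatch_indic.
Qed.

(** Written through [slice], the probability is a partial integral of a jointly measurable function,
    so Tonelli gives its measurability in [u]. *)
Lemma measurable_normal_prob_mean m t a A : t != 0 -> measurable A ->
  measurable_fun [set: R] (fun u => normal_prob (m + a * u) t A).
Proof.
move=> t0 mA; under eq_fun do rewrite normal_prob_slice.
apply: (measurable_fun_fubini_tonelli_F (m2 := leb) (slice m t a A)) => //.
exact: measurable_slice.
Qed.

(** This is the convolution of two normal laws in mixture form. After Tonelli, the inner integral in
    [u] is the output density times the total mass of the posterior. *)
Lemma normal_prob_mixture m th s t a q A : 0 < s -> 0 < t -> 0 < q ->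
  q ^+ 2 = t ^+ 2 + a ^+ 2 * s ^+ 2 -> measurable A ->
  (\int[normal_prob th s]_u normal_prob (m + a * u) t A =
   normal_prob (m + a * th) q A)%E.
Proof.
move=> s0 t0 q0 qE mA.
have t0' : t != 0 by rewrite gt_eqF.
rewrite ge0_integral_normal_prob//; last exact: measurable_normal_prob_mean.
pose F (z : R * R) : \bar R := ((normal_pdf th s z.1)%:E * slice m t a A z)%E.
have mF : measurable_fun [set: R * R] F.
  apply: emeasurable_funM; last exact: measurable_slice.
  apply/measurable_EFinP; apply: (@measurableT_comp _ _ _ _ _ _ (normal_pdf th s)) => //.
  exact: measurable_normal_pdf.
have F0 z : (0 <= F z)%E by rewrite mule_ge0// lee_fin normal_pdf_ge0.
transitivity (\int[leb]_u \int[leb]_y F (u, y))%E.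
  apply: eq_integral => u _; rewrite normal_prob_slice /F/= ge0_integralZl//.
  - by apply: measurableT_comp (measurable_slice _ _ _ _) _ => //.
  - by rewrite lee_fin normal_pdf_ge0.
transitivity (\int[leb]_y \int[leb]_u F (u, y))%E.
  exact: (@fubini_tonelli _ _ _ _ _ leb leb F).
transitivity (\int[leb]_y ((normal_pdf (m + a * th) q y)%:E * (\1_A y)%:E))%E.
  apply: eq_integral => y _.
  transitivity (\int[leb]_u (((normal_pdf (m + a * th) q y)%:E * (\1_A y)%:E) *
      (normal_pdf (th + a * s ^+ 2 * (y - m - a * th) / q ^+ 2)
        (s * t / q) u)%:E))%E.
    apply: eq_integral => u _.
    rewrite /F /slice/= muleA -EFinM (@normal_pdf_mixture _ _ _ _ _ q)//.
    by rewrite -!EFinM mulrAC.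
  rewrite ge0_integralZl//=.
  - by rewrite integral_normal_pdf mule1.
  - by apply/measurable_EFinP; exact: measurable_normal_pdf.
  - by move=> u _; rewrite lee_fin normal_pdf_ge0.
  - by rewrite mule_ge0// lee_fin// normal_pdf_ge0.
rewrite /normal_prob [RHS]integral_mkcond.
by apply: eq_integral => x _; rewrite epatch_indic.
Qed.

End gaussian_mixture.

(** * Second moments of normal laws *)

Section normal_second_moment.
Context (R : realType).
Implicit Types m s x : R.
Local Notation leb := (@lebesgue_measure R).

Lemma second_moment_standard_normal_lty :
  (\int[normal_prob 0 1]_x (x ^+ 2)%:E < +oo :> \bar R)%E.
Proof.
rewrite ge0_integral_normal_prob//; last 2 first.
- by apply/measurable_EFinP.
- by move=> x; rewrite lee_fin sqr_ge0.
pose s : R := Num.sqrt 2.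
have s0 : s != 0 by rewrite gt_eqF// sqrtr_gt0.
have s2 : s ^+ 2 = 2 by rewrite sqr_sqrtr.
(* The 4 undoes the division in the bound on [x^2 / 4]; the quotient of peaks passes from the
   normalisation of variance 1 to that of variance 2. *)
pose C : R := 4 * normal_peak 1 / normal_peak s.
have C0 : 0 <= C by rewrite divr_ge0 ?normal_peak_ge0// mulr_ge0// normal_peak_ge0.
apply: (@le_lt_trans _ _ (\int[leb]_x (C%:E * (normal_pdf 0 s x)%:E))%E); last first.
  rewrite ge0_integralZl//=.
  - by rewrite integral_normal_pdf mule1 ltry.
  - by apply/measurable_EFinP; exact: measurable_normal_pdf.
  - by move=> x _; rewrite lee_fin normal_pdf_ge0.
apply: ge0_le_integral => //.
- by move=> x _; rewrite mule_ge0// lee_fin ?normal_pdf_ge0// sqr_ge0.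
- apply: emeasurable_funM; apply/measurable_EFinP => //.
  exact: measurable_normal_pdf.
- apply: emeasurable_funM; apply/measurable_EFinP => //.
  exact: measurable_normal_pdf.
(* From [x^2 / 4 <= exp (x^2 / 4)], the integrand is at most a multiple of the
   density of variance 2. *)
move=> x _; rewrite -!EFinM lee_fin !normal_pdfE// /normal_fun subr0 s2.
set e := expR (- x ^+ 2 / (2 *+ 2)).
have -> : C * (normal_peak s * e) = normal_peak 1 * (4 * e).
  by rewrite /C; field; rewrite gt_eqF// normal_peak_gt0.
rewrite -mulrA ler_pM2l ?normal_peak_gt0// {}/e.
rewrite (_ : - x ^+ 2 / (1 ^+ 2 *+ 2) = - x ^+ 2 / (2 *+ 2) + - (x ^+ 2 / 4)); last first.
  by field.
rewrite expRD expRN [4 * _]mulrC -mulrA ler_pM2l ?expR_gt0//.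
rewrite [_ * x ^+ 2]mulrC.
rewrite ler_pdivrMr ?expR_gt0// -ler_pdivrMl// mulrC.
by apply: le_trans (expR_ge1Dx _); rewrite lerDr.
Qed.

Lemma integral_normal_scale m s (G : R -> R) : 0 < s ->
  continuous G -> (forall x, 0 <= G x) ->
  (\int[leb]_x (G x)%:E = \int[leb]_x (G ((x - m) / s) / s)%:E)%E.
Proof.
move=> s0 cG G0; pose F (x : R^o) := (x - m) / s.
have F'E : F^`()%classic = cst s^-1.
  apply/funext => x; rewrite /F derive1E deriveM// deriveD// derive_cst scaler0.
  by rewrite add0r derive_id derive_cst addr0 scaler1.
have sV0 : 0 < s^-1 by rewrite invr_gt0.
rewrite (@increasing_ge0_integration_by_substitutionT _ F G)//.
- by apply: eq_integral => x _; rewrite F'E.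
- by move=> x y xy; rewrite /F ltr_pM2r// ltrD2r.
- by rewrite F'E => ?; exact: cvg_cst.
- by rewrite F'E; exact: is_cvg_cst.
- by rewrite F'E; exact: is_cvg_cst.
- by apply/gt0_cvgMlNy => //; exact: cvg_addrr_Ny.
- by apply/gt0_cvgMly => //; exact: cvg_addrr.
Qed.

(** The substitution [(x - m) / s] reduces every case to the standard law. What counts is that one
    finite [K] serves all [m] and [s]. *)
Lemma normal_second_moment : exists K : R, forall m s, 0 < s ->
  (\int[normal_prob m s]_x ((x - m) ^+ 2)%:E = (s ^+ 2 * K)%:E)%E.
Proof.
have K0 : (0 <= \int[normal_prob 0 1]_x (x ^+ 2)%:E :> \bar R)%E.
  by apply: integral_ge0 => x _; rewrite lee_fin sqr_ge0.
exists (fine (\int[normal_prob 0 1]_x (x ^+ 2)%:E)%E).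
move=> m s s0; rewrite EFinM fineK; last first.
  by rewrite ge0_fin_numE// second_moment_standard_normal_lty.
rewrite !ge0_integral_normal_prob//; first last.
- by move=> x; rewrite lee_fin sqr_ge0.
- apply/measurable_EFinP; apply: measurable_funX; exact: measurable_funB.
- by move=> x; rewrite lee_fin sqr_ge0.
- by apply/measurable_EFinP.
under [in RHS]eq_integral do rewrite -EFinM.
rewrite (@integral_normal_scale m s (fun x => normal_pdf 0 1 x * x ^+ 2))//; last 2 first.
- move=> x; apply: cvgM; first exact: continuous_normal_pdf.
  exact: exprn_continuous.
- by move=> x; rewrite mulr_ge0 ?normal_pdf_ge0 ?sqr_ge0.
rewrite -ge0_integralZl//; last 3 first.
- apply/measurable_EFinP; apply: measurable_funM => //.
  apply: measurable_funM.
    apply: (@measurableT_comp _ _ _ _ _ _ (normal_pdf 0 1)) => //.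
      exact: measurable_normal_pdf.
    by apply: measurable_funM => //; exact: measurable_funB.
  by apply: measurable_funX; apply: measurable_funM => //; exact: measurable_funB.
- move=> x _; rewrite lee_fin; apply: divr_ge0; last exact: ltW.
  by apply: mulr_ge0; [exact: normal_pdf_ge0|exact: sqr_ge0].
- by rewrite lee_fin sqr_ge0.
apply: eq_integral => x _; rewrite -!EFinM; congr EFin.
rewrite !normal_pdfE ?gt_eqF// !normal_peakE// /normal_fun subr0 expr1n.
rewrite (_ : - ((x - m) / s) ^+ 2 / (1 *+ 2) = - (x - m) ^+ 2 / (s ^+ 2 *+ 2)); last first.
  by field; rewrite gt_eqF.
by field; rewrite !gt_eqF// sqrtr_gt0 mulrn_wgt0// pi_gt0.
Qed.

End normal_second_moment.

(** * Measures given by a density *)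

Section density_measure.
Context d (T : measurableType d) (R : realType).
Variables (mu : {measure set T -> \bar R}) (f : {mfun T >-> R}).

(** The absolute value makes this a measure for every real [f]; the channel density is non-negative
    and unaffected. Being a measure, it can be compared with the joint law on boxes. *)
Definition density_measure (A : set T) : \bar R :=
  (\int[mu]_(x in A) `|f x|%:E)%E.

Let density0 : density_measure set0 = 0%E.
Proof. exact: integral_set0. Qed.

Let density_ge0 A : (0 <= density_measure A)%E.
Proof. by apply: integral_ge0 => x _; rewrite lee_fin. Qed.

Let density_sigma_additive : semi_sigma_additive density_measure.
Proof.
apply: semi_sigma_additive_nng_induced => //.
by apply/measurable_EFinP; exact: measurableT_comp.
Qed.

HB.instance Definition _ := isMeasure.Build _ _ _ density_measure
  density0 density_ge0 density_sigma_additive.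

End density_measure.

(** * The additive Gaussian channel on vectors *)

Section tuple_channel.
Context (R : realType) (d : nat).
Local Notation T := (d.-tuple R).

Lemma integral_isotropic_normal (th : T) (s : R)
    (mu : {measure set T -> \bar R}) (f : 'I_d -> R -> R) :
  isotropic_normal th s mu ->
  (forall j, measurable_fun [set: R] (f j)) -> (forall j u, 0 <= f j u) ->
  (forall j, \int[normal_prob (tnth th j) s]_u (f j u)%:E < +oo)%E ->
  (\int[mu]_x (\prod_j f j (tnth x j))%:E =
   \prod_j \int[normal_prob (tnth th j) s]_u (f j u)%:E)%E.
Proof.
move=> mu_law mf f0 fy.
(* [normal_prob] is a measure on [measurableTypeR R], whose display differs from
   that of [R] although the measurable sets are the same. *)
apply: (@integral_product_law _ _ _ (measurableTypeR R) _ _ mu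
  (fun j x => tnth x j) (fun j => normal_prob (tnth th j) s)) => // j.
exact: measurable_tnth.
Qed.

Definition axpy (a : R) (x w : T) : T :=
  [tuple tnth w j + a * tnth x j | j < d].

Lemma measurable_axpy disp (S : measurableType disp) a (X W : S -> T) :
  measurable_fun setT X -> measurable_fun setT W ->
  measurable_fun setT (fun s => axpy a (X s) (W s)).
Proof.
move=> mX mW; apply/measurable_fun_tnthP => j.
rewrite (_ : _ \o _ = fun s => tnth (W s) j + a * tnth (X s) j); last first.
  by apply/funext => s; rewrite /= tnth_mktuple.
apply: measurable_funD; last apply: measurable_funM => //.
  by apply: (measurableT_comp (measurable_tnth j)).
by apply: (measurableT_comp (measurable_tnth j)).
Qed.

Context {disp} {Omega : measurableType disp} (Pr : probability Omega R).

Definition axpy_RV a (X W : {RV Pr >-> T}) : Omega -> T :=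
  fun w => axpy a (X w) (W w).

Lemma measurable_axpy_RV a (X W : {RV Pr >-> T}) :
  measurable_fun setT (axpy_RV a X W).
Proof. exact: measurable_axpy. Qed.

HB.instance Definition _ a (X W : {RV Pr >-> T}) :=
  isMeasurableFun.Build _ _ _ _ (axpy_RV a X W) (measurable_axpy_RV a X W).

Variables (a s t q : R) (X W : {RV Pr >-> T}) (th m : T).
Hypotheses (s0 : 0 < s) (t0 : 0 < t) (q0 : 0 < q).
Hypothesis qE : q ^+ 2 = t ^+ 2 + a ^+ 2 * s ^+ 2.
Hypothesis X_law : isotropic_normal th s (distribution Pr X).
Hypothesis W_law : isotropic_normal m t (distribution Pr W).
Hypothesis XW_indep : independent_pair Pr X W.

Lemma distribution_pair_indep C : measurable C ->
  distribution Pr (pair_RV X W) C =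
  (distribution Pr X \x distribution Pr W)%E C.
Proof.
by move=> mC; apply/esym; apply: product_measure_unique.
Qed.

(** The conditional probability, given the input [x], that output and input lie in the box. It is
    real-valued so that the product formula for isotropic laws applies to it. *)
Definition channel_kernel (A B : 'I_d -> set R) (x : T) : R :=
  \prod_j (\1_(B j) (tnth x j) *
           fine (normal_prob (tnth m j + a * tnth x j) t (A j))).

Lemma fine_normal_prob u v (A : set R) : measurable A ->
  (fine (normal_prob u v A))%:E = normal_prob u v A.
Proof. by move=> mA; rewrite fineK// fin_num_measure. Qed.

(** By independence the law of [(X, W)] is a product measure, hence the integral over [x] of the
    measure of sections; each section is a box for the noise. *)
Lemma channel_box A B :
  (forall j, measurable (A j)) -> (forall j, measurable (B j)) ->
  distribution Pr (pair_RV (axpy_RV a X W) X) (box A B) =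
  (\int[distribution Pr X]_x (channel_kernel A B x)%:E)%E.
Proof.
move=> mA mB.
pose C : set (T * T) := [set p | box A B (axpy a p.1 p.2, p.1)].
have mC : measurable C.
  have mphi : measurable_fun [set: T * T]
      (fun p : T * T => (axpy a p.1 p.2, p.1)).
    by apply: measurable_fun_pair => //; exact: measurable_axpy.
  by have := mphi measurableT _ (measurable_box mA mB); rewrite setTI.
transitivity (distribution Pr (pair_RV X W) C) => //.
rewrite distribution_pair_indep//.
apply: eq_integral => x _ /=.
(* Once [x] is fixed, the condition on [B j] no longer involves [w]: coordinate [j] of the section
   is a translate of [A j], or empty. *)
rewrite (_ : xsection C x = [set w | forall j,
    [set v | A j (v + a * tnth x j) /\ B j (tnth x j)] (tnth w j)]); last first.
  apply/seteqP; split=> w; rewrite /xsection/= inE/= => h j;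
    by have := h j; rewrite /= tnth_mktuple.
have mAj j : measurable [set v | A j (v + a * tnth x j)].
  have mc : measurable_fun [set: R] (fun v : R => v + a * tnth x j).
    exact: measurable_funD.
  by have := mc measurableT _ (mA j); rewrite setTI.
rewrite (W_law (A := fun j => [set v | A j (v + a * tnth x j) /\ B j (tnth x j)])); last first.
  move=> j; case: (pselect (B j (tnth x j))) => Bx.
    by rewrite (_ : mkset _ = [set v | A j (v + a * tnth x j)])//;
      apply/seteqP; split=> v //= -[].
  by rewrite (_ : mkset _ = set0)//; apply/seteqP; split=> v //= -[].
rewrite -prodEFin; apply: eq_bigr => j _.
rewrite EFinM fine_normal_prob// indicE.
case: (pselect (B j (tnth x j))) => Bx.
  rewrite mem_set// mul1e -normal_prob_shift ?gt_eqF//; congr normal_prob.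
  by apply/seteqP; split=> v //= -[].
rewrite memNset// mul0e (_ : mkset _ = set0) ?measure0//.
by apply/seteqP; split=> v //= -[].
Qed.

(** With no constraint on the input, the integral of the kernel splits over the coordinates into
    one-dimensional normal mixtures. *)
Lemma isotropic_normal_axpy :
  isotropic_normal (axpy a th m) q (distribution Pr (axpy_RV a X W)).
Proof.
move=> A mA.
transitivity (distribution Pr (pair_RV (axpy_RV a X W) X) (box A (fun=> setT))).
  congr (Pr _); apply/seteqP; split=> w /= h j; first by split=> //; exact: h.
  by have [] := h j.
rewrite channel_box//.
rewrite (integral_isotropic_normal X_law
  (f := fun j u => \1_[set: R] u * fine (normal_prob (tnth m j + a * u) t (A j)))).
- apply: eq_bigr => j _; rewrite tnth_mktuple -(@normal_prob_mixture _ _ _ s t a q)//.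
    by apply: eq_integral => u _; rewrite indicT mul1r fine_normal_prob.
  exact: mA.
- move=> j; apply: measurable_funM => //.
  apply: measurableT_comp => //; apply: measurable_normal_prob_mean => //.
  - by rewrite gt_eqF.
  - exact: mA.
- by move=> j u; rewrite mulr_ge0// fine_ge0// measure_ge0.
- move=> j; under eq_integral do rewrite indicT mul1r fine_normal_prob//.
  rewrite (@normal_prob_mixture _ _ _ _ _ _ q)//; last exact: mA.
  by rewrite -fine_normal_prob ?ltry//; exact: mA.
Qed.

End tuple_channel.

(** * Marginals, density ratios and second moments of isotropic laws *)

Section channel_information.
Context (R : realType) (d : nat).
Local Notation T := (d.-tuple R).

Lemma isotropic_normal_marginal (v : T) (r : R)
    (mu : {measure set T -> \bar R}) j (A : set R) :
  isotropic_normal v r mu -> measurable A ->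
  mu [set x | A (tnth x j)] = normal_prob (tnth v j) r A.
Proof.
move=> mu_law mA; pose B k := if k == j then A else setT.
rewrite (_ : mkset _ = [set x | forall k, B k (tnth x k)]); last first.
  apply/seteqP; split=> x /=; rewrite /B.
    by move=> Ax k; case: eqP => // ->.
  by move/(_ j); rewrite eqxx.
rewrite mu_law; last by move=> k; rewrite /B; case: ifP.
rewrite (bigD1 j)//= {1}/B eqxx big1 ?mule1// => k kj.
by rewrite /B (negbTE kj) probability_setT.
Qed.

Lemma measurable_normal_pdfV (m q : R) : q != 0 ->
  measurable_fun [set: R] (fun y => (normal_pdf m q y)^-1).
Proof.
move=> q0; apply: continuous_measurable_fun => y; apply: cvgV.
  by rewrite gt_eqF// normal_pdf_gt0.
exact: continuous_normal_pdf.
Qed.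

(** The denominator cancels against the law of integration. The factor [b] will be the indicator of
    [B j] at the input, constant while the output is integrated. *)
Lemma integral_normal_ratio (c t m q b : R) (A : set R) :
  t != 0 -> q != 0 -> 0 <= b -> measurable A ->
  (\int[normal_prob m q]_y
     (\1_A y * b * (normal_pdf c t y / normal_pdf m q y))%:E =
   (b * fine (normal_prob c t A))%:E)%E.
Proof.
move=> t0 q0 b0 mA.
have mpdf v r : measurable_fun [set: R] (fun y => normal_pdf v r y).
  exact: measurable_normal_pdf.
have mratio : measurable_fun [set: R]
    (fun y => \1_A y * b * (normal_pdf c t y / normal_pdf m q y)).
  apply: measurable_funM; first by apply: measurable_funM => //.
  by apply: measurable_funM => //; exact: measurable_normal_pdfV.
have ratio0 y : 0 <= \1_A y * b * (normal_pdf c t y / normal_pdf m q y).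
  by rewrite mulr_ge0 ?divr_ge0 ?normal_pdf_ge0// mulr_ge0.
rewrite ge0_integral_normal_prob//; last first.
  by apply/measurable_EFinP.
transitivity (\int[lebesgue_measure]_y
    (b%:E * ((normal_pdf c t y)%:E * (\1_A y)%:E)))%E.
  apply: eq_integral => y _; rewrite -!EFinM; congr EFin.
  by field; rewrite gt_eqF// normal_pdf_gt0.
rewrite ge0_integralZl//; last 2 first.
- apply: emeasurable_funM; first by apply/measurable_EFinP; exact: mpdf.
  by apply/measurable_EFinP; exact: measurable_indic.
- by move=> y _; rewrite mule_ge0// lee_fin// normal_pdf_ge0.
rewrite EFinM fine_normal_prob//; congr (_ * _)%E.
rewrite /normal_prob [RHS]integral_mkcond.
by apply: eq_integral => y _; rewrite epatch_indic.
Qed.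

Context {disp} {Omega : measurableType disp} (Pr : probability Omega R).

(** [K] is chosen before the vector, so that output and noise share it. *)
Lemma isotropic_normal_second_moment : exists K : R,
  forall (V : {RV Pr >-> T}) (v : T) (r : R) j, 0 < r ->
  isotropic_normal v r (distribution Pr V) ->
  (\int[Pr]_w ((tnth (V w) j - tnth v j) ^+ 2)%:E = (r ^+ 2 * K)%:E)%E.
Proof.
have [K HK] := normal_second_moment R.
exists K => V v r j r0 V_law; rewrite -(HK (tnth v j))//.
have mVj : measurable_fun [set: Omega] (fun w => tnth (V w) j).
  by apply: (measurableT_comp (measurable_tnth j)).
transitivity (\int[Pr]_w ((cst (1:R) w)%:E *
    ((tnth (V w) j - tnth v j) ^+ 2)%:E))%E.
  by apply: eq_integral => w _; rewrite mul1e.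
rewrite (@ge0_weighted_integral _ _ _ (measurableTypeR R) _ Pr
  (normal_prob (tnth v j) r) (fun w => tnth (V w) j) (cst 1) 1 _ _ _ _
  (fun x => ((x - tnth v j) ^+ 2)%:E)) ?mul1e//.
- move=> A mA; rewrite mul1e.
  apply: (etrans _ (isotropic_normal_marginal j V_law mA)).
  rewrite [RHS](_ : _ = Pr [set w | A (tnth (V w) j)])//.
  have mVA : measurable [set w | A (tnth (V w) j)].
    by have := mVj measurableT A mA; rewrite setTI.
  rewrite -[X in Pr X]setIT -(integral_indic Pr measurableT mVA).
  by apply: eq_integral => w _; rewrite mul1e.
- apply/measurable_EFinP; apply: measurable_funX; exact: measurable_funB.
- by move=> x; rewrite lee_fin sqr_ge0.
Qed.

End channel_information.

(** * Joint density and mutual information of the channel *)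

Section channel_information.
Context (R : realType) (d : nat).
Local Notation T := (d.-tuple R).
Context {disp} {Omega : measurableType disp} (Pr : probability Omega R).
Variables (a s t q : R) (X W : {RV Pr >-> T}) (th m : T).
Hypotheses (s0 : 0 < s) (t0 : 0 < t) (q0 : 0 < q).
Hypothesis qE : q ^+ 2 = t ^+ 2 + a ^+ 2 * s ^+ 2.
Hypothesis X_law : isotropic_normal th s (distribution Pr X).
Hypothesis W_law : isotropic_normal m t (distribution Pr W).
Hypothesis XW_indep : independent_pair Pr X W.

Let Y := axpy_RV a X W : {RV Pr >-> T}.
Let t0' : t != 0. Proof. by rewrite gt_eqF. Qed.
Let q0' : q != 0. Proof. by rewrite gt_eqF. Qed.

Definition channel_ratio j (y u : R) : R :=
  normal_pdf (tnth m j + a * u) t y / normal_pdf (tnth (axpy a th m) j) q y.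

Definition channel_density (z : T * T) : R :=
  \prod_j channel_ratio j (tnth z.1 j) (tnth z.2 j).

Lemma channel_ratio_gt0 j y u : 0 < channel_ratio j y u.
Proof. by rewrite divr_gt0 ?normal_pdf_gt0. Qed.

Lemma measurable_channel_ratio j :
  measurable_fun [set: R * R] (fun z : R * R => channel_ratio j z.1 z.2).
Proof.
apply: measurable_funM.
  rewrite (_ : (fun z => _) =
    (fun z : R * R => normal_pdf (tnth m j + a * z.1) t z.2) \o
    (fun z : R * R => (z.2, z.1)))//.
  apply: measurableT_comp; last exact: measurable_fun_pair.
  exact: measurable_normal_pdf_channel.
apply: (@measurableT_comp _ _ _ _ _ _
  (fun y => (normal_pdf (tnth (axpy a th m) j) q y)^-1)) => //.
exact: measurable_normal_pdfV.
Qed.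

Lemma measurable_tnth_fst (j : 'I_d) :
  measurable_fun [set: T * T] (fun z : T * T => tnth z.1 j).
Proof. by apply: (measurableT_comp (measurable_tnth j)). Qed.

Lemma measurable_tnth_snd (j : 'I_d) :
  measurable_fun [set: T * T] (fun z : T * T => tnth z.2 j).
Proof. by apply: (measurableT_comp (measurable_tnth j)). Qed.

Lemma measurable_channel_density : measurable_fun [set: T * T] channel_density.
Proof.
apply: measurable_prod => j _.
apply: (@measurableT_comp _ _ _ _ _ _ (fun z : R * R => channel_ratio j z.1 z.2)
  _ (fun z : T * T => (tnth z.1 j, tnth z.2 j))).
  exact: measurable_channel_ratio.
apply: measurable_fun_pair; [exact: measurable_tnth_fst|exact: measurable_tnth_snd].
Qed.

Lemma channel_density_ge0 z : 0 <= channel_density z.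
Proof. by apply: prodr_ge0 => j _; rewrite ltW// channel_ratio_gt0. Qed.

(** Tonelli with the output integrated first: for a fixed input the integrand factors over the
    coordinates, and each ratio integrates to a factor of the kernel. *)
Lemma integral_channel_density_box A B :
  (forall j, measurable (A j)) -> (forall j, measurable (B j)) ->
  (\int[distribution Pr Y \x distribution Pr X]_(z in box A B)
     (channel_density z)%:E =
   \int[distribution Pr X]_x (channel_kernel a t m A B x)%:E)%E.
Proof.
move=> mA mB.
(* The indicator of the box is absorbed coordinate by coordinate, so that the whole integrand is a
   product over [j]. *)
pose g (z : T * T) : R := \prod_j (\1_(A j) (tnth z.1 j) * \1_(B j) (tnth z.2 j) *
  channel_ratio j (tnth z.1 j) (tnth z.2 j)).
have mg : measurable_fun [set: T * T] g.
  apply: measurable_prod => j _; apply: measurable_funM.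
    apply: measurable_funM.
      apply: (measurableT_comp (measurable_indic (mA j))).
      exact: measurable_tnth_fst.
    apply: (measurableT_comp (measurable_indic (mB j))).
    exact: measurable_tnth_snd.
  apply: (@measurableT_comp _ _ _ _ _ _ (fun z : R * R => channel_ratio j z.1 z.2)
    _ (fun z : T * T => (tnth z.1 j, tnth z.2 j))).
    exact: measurable_channel_ratio.
  apply: measurable_fun_pair; [exact: measurable_tnth_fst|exact: measurable_tnth_snd].
have g0 z : 0 <= g z.
  by apply: prodr_ge0 => j _; rewrite mulr_ge0// ltW// channel_ratio_gt0.
transitivity (\int[distribution Pr Y \x distribution Pr X]_z (g z)%:E)%E.
  rewrite integral_mkcond; apply: eq_integral => z _.
  rewrite epatch_indic -EFinM; congr EFin; rewrite /g indicE.
  case: (boolP (z \in _)) => [/set_mem/= zAB|/negP zAB].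
    rewrite mulr1; apply: eq_bigr => j _.
    by have [? ?] := zAB j; rewrite !indicE !mem_set// !mul1r.
  have [j nAB] : exists j, ~ (A j (tnth z.1 j) /\ B j (tnth z.2 j)).
    by apply/existsNP => h; apply: zAB; apply/mem_set.
  rewrite mulr0 (bigD1 j)//= !indicE.
  by case/not_andP: nAB => nx; rewrite (memNset nx) ?(mul0r, mulr0).
rewrite (fubini_tonelli2 (EFin \o g))//=; last exact/measurable_EFinP.
apply: eq_integral => x _; rewrite /fubini_G/= /g/=.
rewrite (integral_isotropic_normal (isotropic_normal_axpy s0 t0 q0 qE X_law W_law XW_indep)
  (f := fun j y => \1_(A j) y * \1_(B j) (tnth x j) * channel_ratio j y (tnth x j))).
- rewrite -prodEFin; apply: eq_bigr => j _.
  by rewrite integral_normal_ratio//; exact: mA.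
- move=> j; apply: measurable_funM.
    apply: measurable_funM => //; exact: measurable_indic.
  apply: (@measurableT_comp _ _ _ _ _ _ (fun z : R * R => channel_ratio j z.1 z.2)
    _ (fun y => (y, tnth x j))).
    exact: measurable_channel_ratio.
  exact: measurable_fun_pair.
- by move=> j y; rewrite mulr_ge0// ltW// channel_ratio_gt0.
- by move=> j; rewrite integral_normal_ratio// ?ltry//; exact: mA.
Qed.

(** Both sides are measures that give a box the same value, the integral of the channel kernel. The
    density is bundled as a measurable function to make the right side a [density_measure]. *)
Lemma channel_densityP C : measurable C ->
  distribution Pr (pair_RV Y X) C =
  (\int[distribution Pr Y \x distribution Pr X]_(z in C) (channel_density z)%:E)%E.
Proof.
move=> mC.
pose f_mixin := isMeasurableFun.Build _ _ _ _ _ measurable_channel_density.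
pose f : {mfun (T * T)%type >-> R} := HB.pack channel_density f_mixin.
transitivity (density_measure (distribution Pr Y \x distribution Pr X)%E f C); last first.
  by apply: eq_integral => z _; rewrite ger0_norm// channel_density_ge0.
apply: measure_eq_box mC => [A B mA mB|].
  transitivity (\int[distribution Pr X]_x (channel_kernel a t m A B x)%:E)%E.
    exact: channel_box.
  rewrite -integral_channel_density_box//.
  by apply: eq_integral => z _; rewrite ger0_norm// channel_density_ge0.
by rewrite ltey_eq fin_num_measure.
Qed.

Definition channel_log_ratio j (y u : R) : R := ln (q / t) +
  ((y - tnth (axpy a th m) j) ^+ 2 / (2 * q ^+ 2) -
   (y - (tnth m j + a * u)) ^+ 2 / (2 * t ^+ 2)).

Lemma ln_channel_ratio j y u :
  ln (channel_ratio j y u) = channel_log_ratio j y u.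
Proof.
rewrite /channel_log_ratio -[X in _ = _ + X]expRK -lnM ?posrE ?expR_gt0 ?divr_gt0//.
congr ln; rewrite /channel_ratio !normal_pdfE// !normal_peakE// /normal_fun.
rewrite !mulNr -(mulr_natl (t ^+ 2)) -(mulr_natl (q ^+ 2)) expRD !expRN.
have k0 : 0 < Num.sqrt (pi *+ 2) :> R by rewrite sqrtr_gt0 mulrn_wgt0// pi_gt0.
by field; rewrite !gt_eqF// expR_gt0.
Qed.

Lemma ln_channel_density z : ln (channel_density z) =
  \sum_j channel_log_ratio j (tnth z.1 j) (tnth z.2 j).
Proof.
rewrite /channel_density.
(* Positivity of the partial products is carried along, because [ln] turns products into sums only
   on positive reals. *)
suff [] : 0 < \prod_j channel_ratio j (tnth z.1 j) (tnth z.2 j) /\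
  ln (\prod_j channel_ratio j (tnth z.1 j) (tnth z.2 j)) =
  \sum_j channel_log_ratio j (tnth z.1 j) (tnth z.2 j) by [].
apply: (big_rec2 (fun x y => 0 < x /\ ln x = y)); first by rewrite ln1.
move=> j x y _ [x0 <-]; have r0 := channel_ratio_gt0 j (tnth z.1 j) (tnth z.2 j).
by rewrite mulr_gt0// lnM ?posrE// ln_channel_ratio.
Qed.

Lemma mutual_information_axpy :
  mutual_information Y X = (d%:R * ln (q / t))%:E.
Proof.
rewrite /mutual_information.
rewrite (kl_divergence_density measurable_channel_density channel_density_ge0);
  last exact: channel_densityP.
pose h j (w : Omega) : R := channel_log_ratio j (tnth (Y w) j) (tnth (X w) j).
have [K HK] := isotropic_normal_second_moment d Pr.
have Y_law := isotropic_normal_axpy s0 t0 q0 qE X_law W_law XW_indep.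
(* Dividing by [2 r^2] removes the scale, so output and noise both get expectation [K / 2]. *)
have sq_int (V : {RV Pr >-> T}) v r j : 0 < r ->
    isotropic_normal v r (distribution Pr V) ->
    Pr.-integrable setT
      (EFin \o (fun w => (tnth (V w) j - tnth v j) ^+ 2 / (2 * r ^+ 2))) /\
    (\int[Pr]_w ((tnth (V w) j - tnth v j) ^+ 2 / (2 * r ^+ 2))%:E = (K / 2)%:E)%E.
  move=> r0 V_law.
  have mV : measurable_fun setT (fun w => (tnth (V w) j - tnth v j) ^+ 2).
    apply: measurable_funX; apply: measurable_funB => //.
    by apply: (measurableT_comp (measurable_tnth j)).
  have isq : Pr.-integrable setT (EFin \o (fun w => (tnth (V w) j - tnth v j) ^+ 2)).
    apply/integrableP; split; first exact/measurable_EFinP.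
    under eq_integral do rewrite /= ger0_norm ?sqr_ge0//.
    by rewrite (HK V v r)// ltry.
  have E : (EFin \o (fun w => (tnth (V w) j - tnth v j) ^+ 2 / (2 * r ^+ 2)) =
      (fun w => (2 * r ^+ 2)^-1%:E * ((tnth (V w) j - tnth v j) ^+ 2)%:E)%E).
    by apply/funext => w /=; rewrite -EFinM mulrC.
  split; first by rewrite E; exact: integrableZl.
  rewrite [LHS](_ : _ = \int[Pr]_w
      ((2 * r ^+ 2)^-1%:E * ((tnth (V w) j - tnth v j) ^+ 2)%:E))%E; last first.
    by apply: eq_integral => w _; rewrite -EFinM mulrC.
  rewrite integralZl// (HK V v r)// -EFinM; congr EFin.
  by field; rewrite gt_eqF.
have hE j w : h j w = ln (q / t) +
    ((tnth (Y w) j - tnth (axpy a th m) j) ^+ 2 / (2 * q ^+ 2) -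
     (tnth (W w) j - tnth m j) ^+ 2 / (2 * t ^+ 2)).
  (* The residual of the output given the input is the centred noise, so each quadratic term depends
     on [Y] alone or on [W] alone. *)
  have WE : tnth (Y w) j - (tnth m j + a * tnth (X w) j) =
      tnth (W w) j - tnth m j.
    by rewrite tnth_mktuple; ring.
  by rewrite /h /channel_log_ratio WE.
have h_int j : Pr.-integrable setT (EFin \o h j) /\
    (\int[Pr]_w (h j w)%:E = (ln (q / t))%:E)%E.
  have [iY eY] := sq_int Y _ _ j q0 Y_law.
  have [iW eW] := sq_int W _ _ j t0 W_law.
  have iYW := integrableB measurableT iY iW.
  have ic := finite_measure_integrable_cst Pr (ln (q / t)) measurableT.
  have E : EFin \o h j = (EFin \o cst (ln (q / t)) \+
    ((EFin \o (fun w => (tnth (Y w) j - tnth (axpy a th m) j) ^+ 2 /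
        (2 * q ^+ 2))%R) \-
     (EFin \o (fun w => (tnth (W w) j - tnth m j) ^+ 2 / (2 * t ^+ 2))%R)))%E.
    by apply/funext => w /=; rewrite hE.
  split; first by rewrite E; exact: integrableD.
  rewrite -[LHS]/(\int[Pr]_w (EFin \o h j) w)%E E integralD//.
  rewrite integralB// eY eW subee// adde0.
  rewrite -[LHS]/(\int[Pr]_w cst (ln (q / t))%:E w)%E.
  rewrite integral_cst//; apply: etrans (mule1 _); congr (_ * _)%E.
  exact: probability_setT.
have lneE z : lne (channel_density z)%:E = (ln (channel_density z))%:E.
  by rewrite lne_EFin// prodr_gt0// => j _; exact: channel_ratio_gt0.
under eq_integral do rewrite lneE.
rewrite integral_distribution; last 2 first.
- apply/measurable_EFinP; apply: measurableT_comp => //.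
  exact: measurable_channel_density.
- rewrite (_ : _ \o _ = fun w => (\sum_j (EFin \o h j) w)%E).
    by apply: integrable_sum => // j _; case: (h_int j).
  by apply/funext => w /=; rewrite ln_channel_density sumEFin.
transitivity (\int[Pr]_w (\sum_j (EFin \o h j) w))%E.
  by apply: eq_integral => w _ /=; rewrite ln_channel_density sumEFin.
rewrite integral_sum//; last by move=> j; case: (h_int j).
rewrite (eq_bigr (fun=> (ln (q / t))%:E)); last by move=> j _; case: (h_int j).
by rewrite sumEFin sumr_const card_ord mulr_natl.
Qed.

End channel_information.

(** * Noise plus a partial sum of users *)

Section user_sums.
Context (R : realType) (n d : nat) {disp} {Omega : measurableType disp}.
Local Notation T := (d.-tuple R).
Context (Pr : probability Omega R).
Variables (a sigma sigma0 : R) (theta : T).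
Variables (U : 'I_n -> {RV Pr >-> T}) (Z : {RV Pr >-> T}).
Hypotheses (sigma_gt0 : 0 < sigma) (sigma0_gt0 : 0 < sigma0).
Hypothesis U_law : forall i, isotropic_normal theta sigma (distribution Pr (U i)).
Hypothesis U_indep : independent_family Pr (fun i => U i : Omega -> T).
Hypothesis Z_law : isotropic_normal [tuple 0 | _ < d] sigma0 (distribution Pr Z).
Hypothesis Z_indep : independent_pair Pr Z (fun w => [tuple U i w | i < n]).

Definition sum_std (k : nat) : R :=
  Num.sqrt (sigma0 ^+ 2 + k%:R * (a ^+ 2 * sigma ^+ 2)).

Lemma sum_std_gt0 k : 0 < sum_std k.
Proof.
by rewrite sqrtr_gt0 ltr_pwDl ?exprn_gt0// mulr_ge0// mulr_ge0// sqr_ge0.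
Qed.

Lemma sum_std_sqr k :
  sum_std k ^+ 2 = sigma0 ^+ 2 + k%:R * (a ^+ 2 * sigma ^+ 2).
Proof.
by rewrite sqr_sqrtr// addr_ge0 ?sqr_ge0// mulr_ge0// mulr_ge0// sqr_ge0.
Qed.

Definition user_event (B : 'I_n -> set T) : set Omega :=
  \bigcap_(l in [set: 'I_n]) (U l @^-1` B l).

(* Taking [B l] to be the whole space on [r], the event [user_event B] only
   constrains the users outside [r]. *)
Definition indep_of_users_outside (r : seq 'I_n) (S : {RV Pr >-> T}) : Prop :=
  forall (A : set T) (B : 'I_n -> set T), measurable A ->
    (forall l, measurable (B l)) -> (forall l, l \in r -> B l = setT) ->
    Pr (S @^-1` A `&` user_event B) =
    (Pr (S @^-1` A) * \prod_l Pr (U l @^-1` B l))%E.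

Let measurable_RV (V : {RV Pr >-> T}) A : measurable A -> measurable (V @^-1` A).
Proof. by move=> mA; rewrite -[X in measurable X]setTI; exact: measurable_funP. Qed.

Lemma measurable_user_event B : (forall l, measurable (B l)) ->
  measurable (user_event B).
Proof.
by move=> mB; apply: fin_bigcap_measurable => // l _; exact: measurable_RV.
Qed.

Lemma noise_indep_of_users : indep_of_users_outside [::] Z.
Proof.
move=> A B mA mB _.
have -> : user_event B = (fun w => [tuple U i w | i < n]) @^-1`
    [set u | forall l, B l (tnth u l)].
  apply/seteqP; split=> w h l; first by rewrite tnth_mktuple; exact: h.
  by move=> _; have := h l; rewrite tnth_mktuple.
rewrite Z_indep//; last exact: measurable_tuple_box.
congr (_ * _)%E.
transitivity (Pr (\bigcap_(i in [set` [set: 'I_n]%SET]) (U i @^-1` B i))).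
  congr (Pr _); apply/seteqP; split=> w h l.
    by move=> _; have := h l; rewrite tnth_mktuple.
  by rewrite tnth_mktuple; apply: h; rewrite /= finset.inE.
by rewrite U_indep//; apply: eq_bigl => l; rewrite finset.inE.
Qed.

Lemma indep_of_users_pair k r S : k \notin r -> indep_of_users_outside r S ->
  independent_pair Pr (U k) S.
Proof.
move=> kr indS A B mA mB.
(* Constraining user [k] alone is allowed, as [k] is outside [r]; all other factors of the product
   are then 1. *)
pose C l := if l == k then A else setT.
have mC l : measurable (C l) by rewrite /C; case: ifP.
have prodC : (\prod_l Pr (U l @^-1` C l) = Pr (U k @^-1` A))%E.
  rewrite (bigD1 k)//= {1}/C eqxx big1 ?mule1// => l lk.
  by rewrite /C (negbTE lk) preimage_setT probability_setT.
rewrite setIC [RHS]muleC -prodC -indS//; last first.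
  by move=> l lr; rewrite /C; case: eqP lr kr => // -> ->.
congr (Pr (_ `&` _)); apply/seteqP; split=> w /= h.
  by move=> l _; rewrite /C; case: eqP => // ->.
by have := h k I; rewrite /C eqxx.
Qed.

(** The inductive step: adding user [k] preserves joint independence from the users still outside,
    which the next addition relies on. *)
Lemma indep_of_users_axpy k r S : k \notin r -> indep_of_users_outside r S ->
  indep_of_users_outside (k :: r) (axpy_RV a (U k) S : {RV Pr >-> T}).
Proof.
move=> kr indS A B mA mB Br.
have mE := measurable_user_event mB.
have Bk : B k = setT by apply: Br; rewrite mem_head.
set c := (\prod_l Pr (U l @^-1` B l))%E.
have c0 : (0 <= c)%E by apply: prode_ge0 => l _; exact: measure_ge0.
have cfin : c \is a fin_num.
  by apply: prode_fin_num => l _; rewrite fin_num_measure//; exact: measurable_RV.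
have pUS := indep_of_users_pair kr indS.
pose C : set (T * T) := [set p | A (axpy a p.1 p.2)].
have mC : measurable C.
  have mphi : measurable_fun [set: T * T] (fun p : T * T => axpy a p.1 p.2).
    exact: measurable_axpy.
  by have := mphi measurableT _ mA; rewrite setTI.
(* On [user_event B], the law of [(U k, S)] is the restricted measure below;
   comparing rectangles shows that it is [c] times the unrestricted law. *)
pose cN := NngNum (fine_ge0 c0).
have cNE : (cN%:num)%:E = c by rewrite /= fineK.
suff : (pushforward (mrestr Pr mE) (pair_RV (U k) S) C =
        mscale cN (distribution Pr (pair_RV (U k) S)) C)%E.
  by rewrite /mscale cNE muleC.
apply: (@measure_eq_rectangle _ _ _ _ _
  (pushforward (mrestr Pr mE) (pair_RV (U k) S))
  (mscale cN (distribution Pr (pair_RV (U k) S)))) => //; last first.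
  rewrite -[X in (X < _)%E]/(Pr (setT `&` user_event B)) setTI.
  by rewrite (le_lt_trans (probability_le1 _ mE))// ltry.
move=> A1 A2 mA1 mA2; rewrite /mscale cNE.
rewrite -[LHS]/(Pr (U k @^-1` A1 `&` S @^-1` A2 `&` user_event B)).
transitivity (c * Pr (U k @^-1` A1 `&` S @^-1` A2))%E; last first.
  by congr (_ * _)%E.
rewrite pUS//.
(* [B k] is the whole space, so the event [A1] on [U k] can take its place and the independence of
   [S] from the users outside [r] applies. *)
pose D l := if l == k then A1 else B l.
have mD l : measurable (D l) by rewrite /D; case: ifP.
have -> : U k @^-1` A1 `&` S @^-1` A2 `&` user_event B =
    S @^-1` A2 `&` user_event D.
  apply/seteqP; split=> w /=.
    move=> [[A1w A2w] Bw]; split=> // l _; rewrite /D.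
    by case: eqP => [->//|_]; exact: Bw.
  move=> [A2w Dw]; have := Dw k I; rewrite /D eqxx => A1w; do ?split => //.
  by move=> l _; have := Dw l I; rewrite /D; case: eqP => [->|//]; rewrite Bk.
rewrite indS//; last first.
  move=> l lr; rewrite /D; case: eqP lr kr => [-> -> //|_ lr _].
  by apply: Br; rewrite inE lr orbT.
rewrite (bigD1 k)//= {1}/D eqxx /c [in RHS](bigD1 k)//= Bk preimage_setT.
rewrite probability_setT mul1e.
rewrite (eq_bigr (fun l => Pr (U l @^-1` B l))); last first.
  by move=> l lk; rewrite /D (negbTE lk).
by rewrite [RHS]muleC muleCA -muleA.
Qed.

(** The mean [v] stays existential because the mutual information depends on the deviations only. By
    [uniq], each added user is new to the sum, hence independent of it. *)
Lemma exists_user_sum (r : seq 'I_n) : uniq r -> exists S : {RV Pr >-> T},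
  [/\ forall w j, tnth (S w) j = \sum_(l <- r) a * tnth (U l w) j + tnth (Z w) j,
      exists v : T, isotropic_normal v (sum_std (size r)) (distribution Pr S) &
      indep_of_users_outside r S].
Proof.
elim: r => [_|k r IH /= /andP[kr ur]].
  exists Z; split.
  - by move=> w j; rewrite big_nil add0r.
  - exists [tuple 0 | _ < d].
    by rewrite /sum_std mul0r addr0 sqrtr_sqr gtr0_norm.
  - exact: noise_indep_of_users.
have [S [SE [v S_law] indS]] := IH ur.
exists (axpy_RV a (U k) S); split.
- move=> w j; rewrite /axpy_RV tnth_mktuple SE big_cons; ring.
- exists (axpy a theta v).
  apply: (isotropic_normal_axpy sigma_gt0 (sum_std_gt0 (size r)) (sum_std_gt0 _) _
    (U_law k) S_law (indep_of_users_pair kr indS)).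
  by rewrite !sum_std_sqr -[(size r).+1]addn1 natrD; ring.
- exact: indep_of_users_axpy.
Qed.

End user_sums.

(** * The information bound for a single user *)

Theorem proposition1 (R : realType) (n d : nat) (sigma B P sigma0 : R)
    (hn : (1 <= n)%N) (hd : (1 <= d)%N)
    (hsigma : 0 < sigma) (hB : 0 < B) (hP : 0 < P) (hsigma0 : 0 < sigma0)
    (disp : measure_display) (Omega : measurableType disp)
    (theta : d.-tuple R) (htheta : param_space B theta)
    (Pr : probability Omega R)
    (U : 'I_n -> {RV Pr >-> d.-tuple R}) (Z Y : {RV Pr >-> d.-tuple R})
    (U_law : forall i, isotropic_normal theta sigma (distribution Pr (U i)))
    (U_indep : independent_family Pr (fun i => U i : Omega -> d.-tuple R))
    (Z_law : isotropic_normal [tuple 0 | _ < d] sigma0 (distribution Pr Z))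
    (Z_indep : independent_pair Pr Z (fun w => [tuple U i w | i < n]))
    (Y_def : forall w, Y w = mac_output (fun i => encoder P B sigma (U i w)) (Z w))
    (i : 'I_n) :
  (mutual_information Y (U i) <=
   (d%:R / 2 *
    (1 / (n%:R - 1 +
          sigma0 ^+ 2 * (B ^+ 2 + sigma ^+ 2) / (P * sigma ^+ 2))))%:E)%E.
Proof.
have D0 : 0 < B ^+ 2 + sigma ^+ 2 by rewrite addr_gt0// exprn_gt0.
pose a : R := Num.sqrt (P / (B ^+ 2 + sigma ^+ 2)).
have a2 : a ^+ 2 = P / (B ^+ 2 + sigma ^+ 2).
  by rewrite sqr_sqrtr// divr_ge0// ltW.
(* Listing all users other than [i] makes [S] the total noise seen by user [i]; the list has length
   [n - 1]. *)
have [S [SE [v S_law] indS]] := exists_user_sum a hsigma hsigma0 U_law U_indep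
  Z_law Z_indep (enum_uniq (predC1 i)).
have iS : i \notin enum (predC1 i) by rewrite mem_enum inE eqxx.
rewrite (_ : Y = (axpy_RV a (U i) S : {RV Pr >-> d.-tuple R})); last first.
  apply/mfuneqP => w; rewrite Y_def; apply: eq_from_tnth => j.
  rewrite tnth_mktuple [RHS]tnth_mktuple SE big_enum/= (bigD1 i)//= tnth_mktuple.
  rewrite -addrA [LHS]addrC; congr (_ + _ + _).
  by apply: eq_bigr => k _; rewrite tnth_mktuple.
set k := size (enum (predC1 i)) in S_law.
have kE : k%:R = n%:R - 1 :> R.
  by rewrite /k -cardE cardC1 card_ord -subn1 natrB.
pose t := sum_std a sigma sigma0 k; pose q := sum_std a sigma sigma0 k.+1.
have t0 : 0 < t by exact: sum_std_gt0.
have q0 : 0 < q by exact: sum_std_gt0.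
have t2 : t ^+ 2 = sigma0 ^+ 2 + k%:R * (a ^+ 2 * sigma ^+ 2).
  exact: sum_std_sqr.
have qE : q ^+ 2 = t ^+ 2 + a ^+ 2 * sigma ^+ 2.
  by rewrite t2 sum_std_sqr -[k.+1]addn1 natrD; ring.
rewrite (mutual_information_axpy hsigma t0 q0 qE (U_law i) S_law
  (indep_of_users_pair iS indS)) lee_fin -mulrA ler_wpM2l//.
have snr_gt0 : 0 < a ^+ 2 * sigma ^+ 2.
  by rewrite a2 mulr_gt0 ?exprn_gt0// divr_gt0.
(* Since [a^2 sigma^2 = P sigma^2 / (B^2 + sigma^2)], dividing [t^2] by it gives exactly the
   denominator of the bound: the other users contribute [n - 1] and the channel noise the remaining
   fraction. *)
have -> : 1 / (n%:R - 1 + sigma0 ^+ 2 * (B ^+ 2 + sigma ^+ 2) / (P * sigma ^+ 2)) =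
    a ^+ 2 * sigma ^+ 2 / t ^+ 2.
  rewrite -kE.
  have -> : sigma0 ^+ 2 * (B ^+ 2 + sigma ^+ 2) / (P * sigma ^+ 2) =
      sigma0 ^+ 2 / (a ^+ 2 * sigma ^+ 2).
    by rewrite a2; field; rewrite !gt_eqF.
  have -> : k%:R + sigma0 ^+ 2 / (a ^+ 2 * sigma ^+ 2) =
      t ^+ 2 / (a ^+ 2 * sigma ^+ 2).
    rewrite t2 mulrDl addrC mulfK//.
    by rewrite gt_eqF.
  by rewrite div1r invf_div.
have qt0 : 0 < q / t by rewrite divr_gt0.
have -> : ln (q / t) = 2^-1 * ln (1 + a ^+ 2 * sigma ^+ 2 / t ^+ 2).
  have -> : 1 + a ^+ 2 * sigma ^+ 2 / t ^+ 2 = (q / t) ^+ 2.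
    by rewrite expr_div_n qE; field; rewrite gt_eqF.
  by rewrite lnXn// mulr2n; field.
rewrite ler_wpM2l// le_ln1Dx// (lt_trans (ltrN10 _))// divr_gt0// exprn_gt0//.
Qed.
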